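(* Let $f=e^{-\psi}$ be an even (i.e. $\psi(x)=\psi(-x)$ for all $x\in\mathbb{R}^n$), nondegenerate, integrable log-concave function on $\mathbb{R}^n$. Then $$(L(f))^\circ=J(f^\circ).$$
   Context: A log-concave function is $f=e^{-\psi}$ with $\psi:\mathbb{R}^n\to\mathbb{R}\cup\{\infty\}$ convex; it is nondegenerate if $\mathrm{int}(\mathrm{supp} f)\ne\emptyset$. The polar of a log-concave $f=e^{-\psi}$ is $f^\circ(y)=\inf_{x:\,f(x)>0}\frac{e^{-\langle x,y\rangle}}{f(x)}=e^{-\mathcal{L}\psi(y)}$, where $\mathcal{L}\psi(y)=\sup_{x\in\mathbb{R}^n}[\langle x,y\rangle-\psi(x)]$. Löwner function: for a nondegenerate integrable log-concave $f=e^{-\psi}$, $L(f)(x)=e^{-\|A_0x\|_2+t_0}$, where $(A_0,t_0)$ minimizes $\int_{\mathbb{R}^n}e^{-\|Ax\|_2+t}dx$ over all $t\in\mathbb{R}$ and invertible affine maps $A$ of $\mathbb{R}^n$ subject to $\|Ax\|_2-t\le\psi(x)$ for all $x$; such a minimizer exists, with $t_0$ unique and $A_0$ unique up to left multiplication by an orthogonal matrix. John function: for a nondegenerate integrable log-concave $f$, $J(f)=s_0\mathbf{1}_{A_0B_2^n}$, where $(s_0,A_0)$ maximizes $s|\det A|$ over all $0<s\le\|f\|_\infty$ and all invertible affine maps $A$ of $\mathbb{R}^n$ (with $\det A$ the determinant of the linear part) subject to $s\mathbf{1}_{AB_2^n}\le f$; the maximizer for the functions considered here exists, with $s_0$ unique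 and $A_0$ unique up to right orthogonal transformations. $B_2^n$ is the closed Euclidean unit ball. *)

(* Defs.v *)
From HB Require Import structures.
From mathcomp Require Import all_boot all_order all_algebra.
From mathcomp Require Import all_classical all_reals all_analysis.
Set Implicit Arguments.
Unset Strict Implicit.
Unset Printing Implicit Defensive.
Import Order.TTheory GRing.Theory Num.Theory.
Import numFieldNormedType.Exports.
Local Open Scope classical_set_scope.
Local Open Scope ring_scope.

Section lebesgue_tuple.
Variable R : realType.
Local Notation RT := (measurableTypeR R).

Definition cons_pair n (p : RT * n.-tuple RT) : n.+1.-tuple RT :=
  [tuple of p.1 :: p.2].

Let measurable_cons_pair n : measurable_fun setT (@cons_pair n).
Proof. exact: measurable_cons. Qed.

(* n-dimensional Lebesgue measure on the Borel sets, as an n-fold product.    *)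
Fixpoint lebesgue_tuple n : set (n.-tuple RT) -> \bar R :=
  match n with
  | 0 => \d_ [tuple]
  | m.+1 => pushforward (lebesgue_measure \x @lebesgue_tuple m)%E (@cons_pair m)
  end.

Section step.
Variables (n : nat) (m : {sigma_finite_measure set (n.-tuple RT) -> \bar R}).

Let step := pushforward (lebesgue_measure \x m)%E (@cons_pair n).

Let step0 : step set0 = 0%E.
Proof. by rewrite /step /pushforward preimage_set0 measure0. Qed.

Let step_ge0 A : (0 <= step A)%E.
Proof. by rewrite /step /pushforward integral_ge0. Qed.

Let step_sigma_additive : semi_sigma_additive step.
Proof.
move=> F mF tF mUF; rewrite /step /pushforward preimage_bigcup.
apply: measure_semi_sigma_additive.
- by move=> k; rewrite -[X in measurable X]setTI; exact: measurable_cons_pair.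
- apply/trivIsetP => i j _ _ ij; rewrite -preimage_setI.
  by move/trivIsetP : tF => /(_ _ _ _ _ ij) ->//; rewrite preimage_set0.
- rewrite -preimage_bigcup -[X in measurable X]setTI.
  exact: measurable_cons_pair.
Qed.

HB.instance Definition _ :=
  isMeasure.Build _ _ _ step step0 step_ge0 step_sigma_additive.

Let step_sigma_finite : sigma_finite setT step.
Proof.
have [F FT Ffin] :=
  sigma_finiteT
    [the {sigma_finite_measure set RT -> \bar R} of lebesgue_measure].
have [G GT Gfin] := sigma_finiteT m.
pose B ij := [set x : n.+1.-tuple RT | F ij.1 (tnth x ord0) /\
                                       G ij.2 [tuple of behead x]].
pose dec k : nat * nat := odflt (0%N, 0%N) (unpickle k).
have behead_cons p : [tuple of behead (cons_pair p)] = p.2 :> n.-tuple RT.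
  exact: val_inj.
have cons_pairB ij : @cons_pair n @^-1` B ij = F ij.1 `*` G ij.2.
  by apply/seteqP; split=> p; rewrite /B /= behead_cons (tnth_nth (p.1)).
exists (B \o dec).
  apply/esym/seteqP; split=> // x _.
  have [i _ Fi] : (\bigcup_i F i) (tnth x ord0) by rewrite -FT.
  have [j _ Gj] : (\bigcup_j G j) [tuple of behead x] by rewrite -GT.
  by exists (pickle (i, j)) => //=; rewrite /dec pickleK.
move=> k; set ij := dec k; split.
  rewrite /= -/ij (_ : B ij = (fun x : n.+1.-tuple RT => tnth x ord0) @^-1` F ij.1 `&`
    (fun x : n.+1.-tuple RT => [tuple of behead x]) @^-1` G ij.2)//.
  apply: measurableI; rewrite -[X in measurable X]setTI.
    by apply: measurable_tnth => //; exact: (Ffin _).1.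
  by apply: measurable_behead => //; exact: (Gfin _).1.
rewrite /step /pushforward /= -/ij cons_pairB.
rewrite product_measure1E; [|exact: (Ffin _).1|exact: (Gfin _).1].
by rewrite lte_mul_pinfty// ?ge0_fin_numE ?(Ffin _).2 ?(Gfin _).2.
Qed.

HB.instance Definition _ :=
  Measure_isSigmaFinite.Build _ _ _ step step_sigma_finite.

Definition lebesgue_step : {sigma_finite_measure set _ -> \bar R} := step.

End step.

Let lebesgue_tuple_measure n :
  {m : {sigma_finite_measure set (n.-tuple RT) -> \bar R} |
    @lebesgue_tuple n = m :> (set (n.-tuple RT) -> \bar R)}.
Proof.
elim: n => [|n [m /= ->]]; first by exists (\d_ [tuple]).
by exists (lebesgue_step m).
Qed.

Let lebesgue_tuple0 n : @lebesgue_tuple n set0 = 0%E.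
Proof. by have [m ->] := lebesgue_tuple_measure n; exact: measure0. Qed.

Let lebesgue_tuple_ge0 n A : (0 <= @lebesgue_tuple n A)%E.
Proof. by have [m ->] := lebesgue_tuple_measure n; exact: measure_ge0. Qed.

Let lebesgue_tuple_sigma_additive n : semi_sigma_additive (@lebesgue_tuple n).
Proof.
have [m ->] := lebesgue_tuple_measure n; exact: measure_semi_sigma_additive.
Qed.

HB.instance Definition _ n := isMeasure.Build _ _ _ (@lebesgue_tuple n)
  (lebesgue_tuple0 n) (@lebesgue_tuple_ge0 n)
  (@lebesgue_tuple_sigma_additive n).

Let lebesgue_tuple_sigma_finite n : sigma_finite setT (@lebesgue_tuple n).
Proof. by have [m ->] := lebesgue_tuple_measure n; exact: sigma_finiteT. Qed.

HB.instance Definition _ n := Measure_isSigmaFinite.Build _ _ _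
  (@lebesgue_tuple n) (@lebesgue_tuple_sigma_finite n).

End lebesgue_tuple.
Arguments lebesgue_tuple {R} n _.

Section definitions.
Variables (R : realType) (n : nat).
Implicit Types (f g : 'rV[R]_n -> R) (psi : 'rV[R]_n -> \bar R).

Definition dot (x y : 'rV[R]_n) : R := (x *m y^T) 0 0.

(* The library norm on 'rV[R]_n is the sup norm.                              *)
Definition enorm (x : 'rV[R]_n) : R := Num.sqrt (dot x x).

Definition eball : set 'rV[R]_n := [set x | enorm x <= 1].

(* The library integral of a nonnegative function is a supremum over Borel    *)
(* simple minorants, with no measurability condition on the integrand; it is  *)
(* the usual integral for every Lebesgue measurable nonnegative function.     *)
Definition integral_rV (g : 'rV[R]_n -> \bar R) : \bar R :=
  (\int[lebesgue_tuple n]_x g (\row_i tnth x i))%E.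

(* Convex functions with values in R U {+oo}; here 0 * +oo = 0.               *)
Definition econvex psi :=
  (forall x, (-oo < psi x)%E) /\
  forall x y (t : R), 0 <= t <= 1 ->
    (psi (t *: x + (1 - t) *: y)%R <= t%:E * psi x + (1 - t)%:E * psi y)%E.

Definition is_expN f psi := forall x, (f x)%:E = expeR (- psi x)%E.

Definition nondegenerate_log_concave f := [set x | 0 < f x]° !=set0.

(* A log-concave function is Lebesgue measurable, though possibly not Borel   *)
(* measurable, so that integrability amounts to finiteness of the integral.   *)
Definition integrable_log_concave f :=
  (integral_rV (fun x => (f x)%:E) < +oo)%E.

(* The psi such that f = e^{-psi}.                                            *)
Definition potential f (x : 'rV[R]_n) : \bar R := (- lne (f x)%:E)%E.

(* For f not identically 0 the infimum is that of a nonempty set of           *)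
(* nonnegative reals.                                                         *)
Definition polar f (y : 'rV[R]_n) : R :=
  inf [set expR (- dot x y) / f x | x in [set x | 0 < f x]].

(* The affine map x |-> T x + b is the pair (T^T, b), vectors being rows.     *)
Definition affine_map : Type := 'M[R]_n * 'rV[R]_n.

Definition affine_app (A : affine_map) (x : 'rV[R]_n) : 'rV[R]_n :=
  x *m A.1 + A.2.

Definition affine_invertible (A : affine_map) := A.1 \in unitmx.

Definition affine_det (A : affine_map) : R := \det A.1.

Definition lowner_fun (A : affine_map) (t : R) (x : 'rV[R]_n) : R :=
  expR (- enorm (affine_app A x) + t).

Definition lowner_feasible f (A : affine_map) (t : R) :=
  affine_invertible A /\
  forall x, ((enorm (affine_app A x) - t)%:E <= potential f x)%E.

Definition lowner_minimizer f (A : affine_map) (t : R) :=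
  lowner_feasible f A t /\
  forall A' t', lowner_feasible f A' t' ->
    (integral_rV (fun x => (lowner_fun A t x)%:E) <=
     integral_rV (fun x => (lowner_fun A' t' x)%:E))%E.

(* Meaningful when a minimizer exists and lowner_fun A t does not depend on   *)
(* the minimizer, as is the case for f nondegenerate integrable log-concave.  *)
Definition lowner f : 'rV[R]_n -> R :=
  xget (fun=> 0) [set g | exists A t, lowner_minimizer f A t /\ g = lowner_fun A t].

Definition sup_norm f : \bar R := ereal_sup (range (fun x => `|f x|%:E)).

Definition john_fun (s : R) (A : affine_map) (x : 'rV[R]_n) : R :=
  s * \1_(affine_app A @` eball) x.

Definition john_feasible f (s : R) (A : affine_map) :=
  [/\ 0 < s, (s%:E <= sup_norm f)%E, affine_invertible A &
      forall x, john_fun s A x <= f x].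

Definition john_maximizer f (s : R) (A : affine_map) :=
  john_feasible f s A /\
  forall s' A', john_feasible f s' A' ->
    s' * `|affine_det A'| <= s * `|affine_det A|.

(* As for lowner, a choice among functions that all coincide.                 *)
Definition john f : 'rV[R]_n -> R :=
  xget (fun=> 0) [set g | exists s A, john_maximizer f s A /\ g = john_fun s A].

End definitions.

(* Main.v *)
Require Import Defs.
From mathcomp Require Import all_boot all_order all_algebra.
From mathcomp Require Import all_classical all_reals all_analysis.
From mathcomp Require Import measurable_realfun ring lra.
Set Implicit Arguments.
Unset Strict Implicit.
Unset Printing Implicit Defensive.
Import Order.TTheory GRing.Theory Num.Theory.
Import numFieldNormedType.Exports.
Local Open Scope classical_set_scope.
Local Open Scope ring_scope.

(* Write |.| for the Euclidean norm, B for its unit ball, (A, b) for the map  *)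
(* x |-> x A + b and f^o for the polar of f. A centred Loewner candidate      *)
(* e^{-|x A| + t} dominates f iff f^o >= e^{-t} on the ellipsoid B A^T, i.e.  *)
(* iff (e^{-t}, (A^T, 0)) is a John candidate for f^o; the polar of the       *)
(* former is e^{-t} 1_{B A^T}, and the objectives c_n e^t / |det A| and       *)
(* e^{-t} |det A| are reciprocal up to the constant c_n. Evenness of f forces *)
(* the optimizers on both sides to be centred: otherwise one could lower t    *)
(* and shrink A, respectively stretch the ellipsoid in the direction of b.    *)
(* Centred optimizers define the same function because averaging two          *)
(* different ones would improve the objective. Existence is not needed: an    *)
(* optimizer on one side yields one on the other, and if there is none then   *)
(* both sides of the identity are 0.                                          *)

(** * Euclidean vectors and Householder reflections *)

(** The support function of an ellipsoid turns the John constraint for the polar into s f(x) <=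
    e^{-(|x A^T| + <x, b>)} for all x ([john_feasible_polarE]); for b = 0 this is the Loewner
    constraint ([lowner_john_feasible]). [integral_lowner_fun] evaluates the Loewner integral, and
    [lowner_john_optimal] then matches centred optimizers of the two problems. All optimizers are
    centred by [lowner_minimizer_center] and [john_maximizer_center], and [lowner_minimizer_unique]
    makes the choice of a minimizer immaterial; through the matching this settles the choice on the
    John side too. [polar_lowner_fun] computes the polar. The change of variables for radial
    integrals and [mean_ellipsoid], behind uniqueness, are inductions on the dimension that rest on
    [householder_block]. *)

Section euclidean.
Variable R : realType.
Implicit Types n : nat.

Lemma dotE n (x y : 'rV[R]_n) : dot x y = \sum_i x 0 i * y 0 i.
Proof. by rewrite /dot mxE; apply: eq_bigr => i _; rewrite mxE. Qed.

Lemma dotC n (x y : 'rV[R]_n) : dot x y = dot y x.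
Proof. by rewrite !dotE; apply: eq_bigr => i _; rewrite mulrC. Qed.

Lemma dotDl n (x y z : 'rV[R]_n) : dot (x + y) z = dot x z + dot y z.
Proof. by rewrite /dot mulmxDl mxE. Qed.

Lemma dotDr n (x y z : 'rV[R]_n) : dot z (x + y) = dot z x + dot z y.
Proof. by rewrite !(dotC z) dotDl. Qed.

Lemma dotZl n a (x y : 'rV[R]_n) : dot (a *: x) y = a * dot x y.
Proof. by rewrite /dot -scalemxAl mxE. Qed.

Lemma dotZr n a (x y : 'rV[R]_n) : dot x (a *: y) = a * dot x y.
Proof. by rewrite dotC dotZl dotC. Qed.

Lemma dotNl n (x y : 'rV[R]_n) : dot (- x) y = - dot x y.
Proof. by rewrite -scaleN1r dotZl mulN1r. Qed.

Lemma dotNr n (x y : 'rV[R]_n) : dot x (- y) = - dot x y.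
Proof. by rewrite dotC dotNl dotC. Qed.

Lemma dot0r n (x : 'rV[R]_n) : dot x 0 = 0.
Proof. by rewrite -(scale0r 0) dotZr mul0r. Qed.

Lemma dot_mulmx n m (x : 'rV[R]_n) (M : 'M[R]_(n, m)) y :
  dot (x *m M) y = dot x (y *m M^T).
Proof. by rewrite /dot trmx_mul trmxK mulmxA. Qed.

Lemma dot_row_mx n m (x1 y1 : 'rV[R]_n) (x2 y2 : 'rV[R]_m) :
  dot (row_mx x1 x2) (row_mx y1 y2) = dot x1 y1 + dot x2 y2.
Proof. by rewrite /dot tr_row_mx mul_row_col mxE. Qed.

Lemma dot_rV1 (x y : 'rV[R]_1) : dot x y = x 0 0 * y 0 0.
Proof. by rewrite dotE big_ord1. Qed.

Lemma dot_ge0 n (x : 'rV[R]_n) : 0 <= dot x x.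
Proof. by rewrite dotE sumr_ge0// => i _; rewrite -expr2 sqr_ge0. Qed.

Lemma dot_eq0 n (x : 'rV[R]_n) : (dot x x == 0) = (x == 0).
Proof.
apply/idP/eqP => [|->]; last by rewrite dot0r.
rewrite dotE psumr_eq0 => [/allP x0|i _]; last by rewrite -expr2 sqr_ge0.
apply/rowP => i; rewrite mxE; have := x0 i (mem_index_enum i).
by rewrite /= mulf_eq0 orbb => /eqP.
Qed.

Lemma mul_tr_rV n (x y z : 'rV[R]_n) : x *m (y^T *m z) = dot x y *: z.
Proof. by rewrite mulmxA [x *m y^T]mx11_scalar mul_scalar_mx. Qed.

Lemma sqr_enorm n (x : 'rV[R]_n) : enorm x ^+ 2 = dot x x.
Proof. by rewrite sqr_sqrtr// dot_ge0. Qed.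

Lemma enorm_ge0 n (x : 'rV[R]_n) : 0 <= enorm x.
Proof. exact: sqrtr_ge0. Qed.

Lemma enorm_gt0 n (x : 'rV[R]_n) : (0 < enorm x) = (x != 0).
Proof. by rewrite sqrtr_gt0 lt0r dot_eq0 dot_ge0 andbT. Qed.

Lemma enormZ n a (x : 'rV[R]_n) : enorm (a *: x) = `|a| * enorm x.
Proof. by rewrite /enorm dotZl dotZr mulrA -expr2 sqrtrM ?sqr_ge0// sqrtr_sqr. Qed.

Lemma enormN n (x : 'rV[R]_n) : enorm (- x) = enorm x.
Proof. by rewrite /enorm dotNl dotNr opprK. Qed.

Lemma enorm0 n : enorm (0 : 'rV[R]_n) = 0.
Proof. by rewrite /enorm dot0r sqrtr0. Qed.

(** Cauchy-Schwarz, by expanding the squared norm of [dot y y *: x - dot x y *: y]. *)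
Lemma dot_enorm n (x y : 'rV[R]_n) : `|dot x y| <= enorm x * enorm y.
Proof.
have [->|y0] := eqVneq y 0; first by rewrite dot0r enorm0 normr0 mulr0.
rewrite -ler_sqr ?nnegrE ?mulr_ge0 ?enorm_ge0//.
rewrite exprMn !sqr_enorm real_normK ?num_real//.
have y_gt0 : 0 < dot y y by rewrite lt0r dot_eq0 y0 dot_ge0.
have := dot_ge0 (dot y y *: x - dot x y *: y).
have -> : dot (dot y y *: x - dot x y *: y) (dot y y *: x - dot x y *: y) =
    dot y y * (dot x x * dot y y - dot x y ^+ 2).
  by rewrite !(dotDl, dotDr, dotZl, dotZr, dotNl, dotNr) (dotC y x); ring.
by rewrite pmulr_rge0// subr_ge0.
Qed.

Lemma ler_enormD n (x y : 'rV[R]_n) : enorm (x + y) <= enorm x + enorm y.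
Proof.
rewrite -ler_sqr ?nnegrE ?addr_ge0 ?enorm_ge0// sqr_enorm sqrrD !sqr_enorm.
rewrite !(dotDl, dotDr) (dotC y x).
have := dot_enorm x y; rewrite ler_norml => /andP[_ ?]; lra.
Qed.

Lemma dot_orth n (x y : 'rV[R]_n) (Q : 'M[R]_n) :
  Q *m Q^T = 1%:M -> dot (x *m Q) (y *m Q) = dot x y.
Proof. by move=> QQ; rewrite dot_mulmx -mulmxA QQ mulmx1. Qed.

Lemma enorm_orth n (x : 'rV[R]_n) (Q : 'M[R]_n) :
  Q *m Q^T = 1%:M -> enorm (x *m Q) = enorm x.
Proof. by move=> QQ; rewrite /enorm dot_orth. Qed.

Lemma sqr_det_orth n (Q : 'M[R]_n) : Q *m Q^T = 1%:M -> \det Q ^+ 2 = 1.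
Proof. by move=> QQ; rewrite expr2 -{2}(det_tr Q) -det_mulmx QQ det1. Qed.

Lemma norm_det_orth n (Q : 'M[R]_n) : Q *m Q^T = 1%:M -> `|\det Q| = 1.
Proof. by move=> /sqr_det_orth/eqP; rewrite sqr_norm_eq1 => /eqP. Qed.

(** Since |v| = |w|, the reflection in the hyperplane orthogonal to u = v - w exchanges v and w; if
    u = 0 the identity serves. *)
Lemma householder n (v : 'rV[R]_(1 + n)) :
  {H : 'M[R]_(1 + n) | H *m H^T = 1%:M &
    v *m H = row_mx (enorm v)%:M 0}.
Proof.
set w := row_mx _ _; pose u := v - w.
have ww : dot w w = dot v v.
  by rewrite dot_row_mx dot0r dot_rV1 !mxE /= mulr1n addr0 -expr2 sqr_enorm.
have uu : dot u u = 2 * dot v u.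
  by rewrite !(dotDl, dotDr, dotNl, dotNr) (dotC w v) ww; ring.
have [u0|u0] := eqVneq u 0.
  exists 1%:M; first by rewrite trmx1 mulmx1.
  by rewrite mulmx1; apply/eqP; rewrite -subr_eq0; apply/eqP.
have q0 : dot u u != 0 by rewrite dot_eq0.
pose c := 2 / dot u u.
pose H := 1%:M - c *: (u^T *m u).
have HT : H^T = H by rewrite /H linearB linearZ /= trmx1 trmx_mul trmxK.
have uH : u *m H = - u.
  rewrite mulmxBr mulmx1 -scalemxAr mul_tr_rV scalerA.
  have -> : c * dot u u = 2 by rewrite /c divfK.
  by rewrite scaler_nat mulr2n opprD addNKr.
exists H.
  rewrite HT {1}/H mulmxBl mul1mx -scalemxAl -mulmxA uH mulmxN scalerN opprK.
  by rewrite subrK.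
rewrite /H mulmxBr mulmx1 -scalemxAr mul_tr_rV scalerA.
have -> : c * dot v u = 1.
  by rewrite /c uu; field; move: q0; rewrite uu mulf_eq0 negb_or => /andP[].
by rewrite scale1r /u opprB addrC subrK.
Qed.

(** One step of an LQ factorization: H turns the first row of M onto the first axis, and a is the
    length of that row. *)
Lemma householder_block n (M : 'M[R]_(1 + n)) : M \in unitmx ->
  exists (H : 'M[R]_(1 + n)) (a : R) (w : 'cV[R]_n) (M' : 'M[R]_n),
    [/\ H *m H^T = 1%:M, 0 < a, M' \in unitmx,
        M *m H = block_mx a%:M 0 w M' & `|\det M| = a * `|\det M'|].
Proof.
move=> uM; have [H HH vH] := householder (usubmx M).
pose N := M *m H.
have N0 : usubmx N = row_mx (enorm (usubmx M))%:M 0 by rewrite -vH mul_usub_mx.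
have NE : N = block_mx (enorm (usubmx M))%:M 0 (dlsubmx N) (drsubmx N).
  by rewrite -[LHS]submxK /ulsubmx /ursubmx N0 row_mxKl row_mxKr.
have detN : `|\det M| = enorm (usubmx M) * `|\det (drsubmx N)|.
  rewrite -[LHS]mulr1 -(norm_det_orth HH) -normrM -det_mulmx -/N NE det_lblock.
  by rewrite normrM det_mx11 mxE eqxx mulr1n ger0_norm ?enorm_ge0// block_mxKdr.
have : 0 < `|\det M| by rewrite normr_gt0 -unitfE -unitmxE.
rewrite detN => d_gt0.
have a_gt0 : 0 < enorm (usubmx M).
  by rewrite lt0r enorm_ge0 andbT; apply: contraTneq d_gt0 => ->; rewrite mul0r ltxx.
exists H, (enorm (usubmx M)), (dlsubmx N), (drsubmx N); split => //.
by rewrite unitmxE unitfE -normr_gt0 -(pmulr_rgt0 _ a_gt0).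
Qed.

(** Take determinants in two block triangular factorizations of one matrix. It measures the volume
    gained by stretching along one direction. *)
Lemma det_rank1 n (u v : 'rV[R]_n) : \det (1%:M + u^T *m v) = 1 + dot v u.
Proof.
have E : block_mx 1%:M 0 u^T 1%:M *m block_mx 1%:M (- v) 0 (1%:M + u^T *m v) =
    block_mx (1%:M + v *m u^T) (- v) 0 1%:M *m
    block_mx 1%:M 0 u^T (1%:M : 'M[R]_n) :> 'M[R]_(1 + n).
  rewrite !mulmx_block !(mulmx1, mul1mx, mulmx0, mul0mx, addr0, add0r).
  by rewrite mulNmx addrK mulmxN addrCA addNr addr0.
have := congr1 determinant E.
rewrite !det_mulmx !(det_lblock, det_ublock) !det1 !mul1r !mulr1 => ->.
by rewrite det_mx11 mxE [X in X + _]mxE.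
Qed.

End euclidean.

(** * Integrals of radial functions *)

Section integration.
Variable R : realType.
Local Notation RT := (measurableTypeR R).
Local Notation mu := (@lebesgue_measure R).

Let measurable_affine (a b : R) :
  measurable_fun [set: RT] (fun x : RT => a * x + b : RT).
Proof. by apply: measurable_funD => //; exact: measurable_funM. Qed.

(** By uniqueness of Lebesgue measure it suffices to test intervals []c, d]]; for a < 0 the open end
    of the preimage moves to the right, which leaves its length unchanged. *)
Lemma lebesgue_measure_affine (a b : R) (A : set RT) : a != 0 -> measurable A ->
  (`|a|%:E * mu ((fun x : RT => a * x + b : RT)%R @^-1` A) = mu A)%E.
Proof.
move=> a0 mA; pose k : {nonneg R} := NngNum (normr_ge0 a).
pose m : {measure set RT -> \bar R} :=
  measure_function_pushforward__canonical__measure_function_Measure mu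
    (measurable_affine a b).
apply/esym/(@lebesgue_measure_unique R (mscale k m)) => //.
move=> _ [[c d]] _ <-.
change (mu `]c, d] =
  (`|a|%:E * mu ((fun x : RT => a * x + b : RT)%R @^-1` `]c, d]))%E).
have [a_gt0|a_lt0|aE] := ltgtP 0 a; last by rewrite -aE eqxx in a0.
- have -> : (fun x : RT => a * x + b)%R @^-1` `]c, d] =
      `](c - b) / a, (d - b) / a]%classic.
    apply/seteqP; split=> x /=; rewrite !in_itv/= ltr_pdivrMr// ler_pdivlMr//;
      rewrite ltrBlDr lerBrDr (mulrC x) //.
  rewrite !lebesgue_measure_itv/= !lte_fin ltr_pM2r ?invr_gt0// ltrD2r.
  case: ifPn => _; last by rewrite mule0.
  rewrite -!EFinD -EFinM gtr0_norm//; congr (_%:E); field.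
  exact: lt0r_neq0.
- have -> : (fun x : RT => a * x + b)%R @^-1` `]c, d] =
      `[(d - b) / a, (c - b) / a[%classic.
    apply/seteqP; split=> x /=; rewrite !in_itv/= ltr_ndivlMr// ler_ndivrMr//;
      rewrite ltrBlDr lerBrDr (mulrC x) andbC //.
  rewrite !lebesgue_measure_itv/= !lte_fin ltr_nM2r ?invr_lt0// ltrD2r.
  case: ifPn => _; last by rewrite mule0.
  rewrite -!EFinD -EFinM ltr0_norm//; congr (_%:E); field.
  exact: ltr0_neq0.
Qed.

Lemma ge0_integral_affine (a b : R) (g : RT -> \bar R) : a != 0 ->
  measurable_fun [set: RT] g -> (forall x, 0 <= g x)%E ->
  (\int[mu]_x g (a * x + b)%R = `|a|^-1%:E * \int[mu]_x g x)%E.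
Proof.
move=> a0 mg g0; pose k : {nonneg R} := NngNum (normr_ge0 a).
pose m : {measure set RT -> \bar R} :=
  measure_function_pushforward__canonical__measure_function_Measure mu
    (measurable_affine a b).
have -> : (\int[mu]_x g x = \int[mscale k m]_x g x)%E.
  apply: eq_measure_integral => A mA _; apply/esym.
  exact: lebesgue_measure_affine.
rewrite ge0_integral_mscale//= muleA -EFinM mulVf ?normr_eq0// mul1e.
rewrite ge0_integral_pushforward//.
Qed.

Definition row_of_tuple n (x : n.-tuple RT) : 'rV[R]_n := \row_i tnth x i.

Lemma row_of_tuple_cons n (x : RT) (y : n.-tuple RT) :
  row_of_tuple [tuple of x :: y] = row_mx (x : R)%:M (row_of_tuple y) :> 'rV_(1 + n).
Proof.
apply/rowP => i; rewrite mxE; case: (split_ordP i) => j ->.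
  by rewrite row_mxEl (ord1 j) mxE eqxx mulr1n (tnth_nth x).
rewrite row_mxEr mxE !(tnth_nth x) /=.
by [].
Qed.

Lemma dot_row_of_tuple_cons n (x : RT) (y : n.-tuple RT) :
  dot (row_of_tuple [tuple of x :: y]) (row_of_tuple [tuple of x :: y]) =
  x * x + dot (row_of_tuple y) (row_of_tuple y).
Proof.
by rewrite row_of_tuple_cons (dot_row_mx (x : R)%:M) dot_rV1 mxE eqxx mulr1n.
Qed.

Lemma measurable_row_of_tuple_dot n (M : 'M[R]_n) (b : 'rV[R]_n) :
  measurable_fun setT (fun x : n.-tuple RT =>
    dot (row_of_tuple x *m M + b) (row_of_tuple x *m M + b) : RT).
Proof.
under eq_fun do rewrite dotE.
apply: measurable_sum => i.
have mi : measurable_fun setT (fun x : n.-tuple RT =>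
    (row_of_tuple x *m M + b) 0 i : RT).
  under eq_fun do rewrite mxE mxE.
  apply: measurable_funD => //.
  apply: measurable_sum => j; apply: measurable_funM => //.
  by under eq_fun do rewrite mxE; exact: measurable_tnth.
exact: measurable_funM.
Qed.

Lemma ge0_integral_tupleS n (g : n.+1.-tuple RT -> \bar R) :
  measurable_fun setT g -> (forall x, 0 <= g x)%E ->
  (\int[lebesgue_tuple n.+1]_x g x =
   \int[lebesgue_tuple n]_y \int[mu]_x g [tuple of x :: y])%E.
Proof.
move=> mg g0.
have mc : measurable_fun setT (@cons_pair R n) by exact: measurable_cons.
rewrite /= ge0_integral_pushforward// preimage_setT.
rewrite (@fubini_tonelli2 _ _ _ _ _ _ _ (g \o @cons_pair R n)) //.
  exact: measurableT_comp.
by move=> x; exact: g0.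
Qed.

(* A radial integrand does not see orthogonal factors on the right of M, so M *)
(* may be assumed block triangular, and one variable is integrated out.       *)
Lemma ge0_integral_radial_affine n (M : 'M[R]_n) (b : 'rV[R]_n)
    (G : RT -> \bar R) :
  M \in unitmx -> measurable_fun [set: RT] G -> (forall r, 0 <= G r)%E ->
  (\int[lebesgue_tuple n]_x
     G (dot (row_of_tuple x *m M + b)%R (row_of_tuple x *m M + b)%R) =
   `|\det M|^-1%:E *
   \int[lebesgue_tuple n]_x G (dot (row_of_tuple x) (row_of_tuple x)))%E.
Proof.
elim: n => [|n IHn] in M b G *.
  move=> _ mG G0; rewrite det_mx00 normr1 invr1 mul1e.
  by apply: eq_integral => x _; rewrite !thinmx0.
move=> uM mG G0.
have [H [a [w [M' [HH a_gt0 uM' MHE detM]]]]] := @householder_block R n M uM.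
pose bH : 'rV[R]_(1 + n) := b *m H.
pose b0 := (lsubmx bH) 0 0.
pose F := (fun p : RT * RT => G (p.1 * p.1 + p.2)%R : \bar R).
have mF : measurable_fun setT F.
  apply: measurableT_comp => //; apply: measurable_funD => //.
  by apply: measurable_funM => //.
(* Integrating out the first coordinate leaves a function of the squared norm r of the others, so
   the induction hypothesis applies to G'. *)
pose G' r : \bar R := (\int[mu]_x F (x, r))%E.
have mG' : measurable_fun [set: RT] G'.
  by apply: (measurable_fun_fubini_tonelli_G F) => // x; exact: G0.
have G'0 r : (0 <= G' r)%E by apply: integral_ge0 => x _; exact: G0.
have mM : measurable_fun setT (fun x : n.+1.-tuple RT =>
    G (dot (row_of_tuple x *m M + b)%R (row_of_tuple x *m M + b)%R)).
  apply: measurableT_comp => //; exact: measurable_row_of_tuple_dot.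
have m1 : measurable_fun setT (fun x : n.+1.-tuple RT =>
    G (dot (row_of_tuple x) (row_of_tuple x))).
  have := measurable_row_of_tuple_dot (1%:M : 'M[R]_(n.+1)) 0.
  under eq_fun do rewrite mulmx1 addr0.
  by move=> ?; exact: measurableT_comp.
rewrite !ge0_integral_tupleS//.
transitivity (\int[lebesgue_tuple n]_y (a^-1%:E *
   G' (dot (row_of_tuple y *m M' + rsubmx bH)%R
           (row_of_tuple y *m M' + rsubmx bH)%R)))%E.
  apply: eq_integral => y _.
  rewrite /G' /F /= -{1}(gtr0_norm a_gt0).
  set r := dot _ _.
  rewrite -(@ge0_integral_affine a ((row_of_tuple y *m w) 0 0 + b0)
    (fun x => G (x * x + r)%R)) //.
  - apply: eq_integral => x _; congr (G _).
    have -> : (a * x + ((row_of_tuple y *m w) 0 0 + b0)) *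
        (a * x + ((row_of_tuple y *m w) 0 0 + b0)) + r =
        dot ((row_of_tuple [tuple of x :: y] *m M + b) *m H)
            ((row_of_tuple [tuple of x :: y] *m M + b) *m H).
      have -> : (row_of_tuple [tuple of x :: y] *m M + b) *m H =
          row_mx ((x : R)%:M *m a%:M + row_of_tuple y *m w + lsubmx bH)
            (row_of_tuple y *m M' + rsubmx bH).
        rewrite mulmxDl -mulmxA MHE row_of_tuple_cons -/bH -[bH in LHS]hsubmxK.
        by rewrite (mul_row_block (x : R)%:M) mulmx0 add0r add_row_mx.
      rewrite dot_row_mx dot_rV1 -scalar_mxM.
      have -> : ((x * a)%:M + row_of_tuple y *m w + lsubmx bH) 0 0 =
          a * x + ((row_of_tuple y *m w) 0 0 + b0).
        by rewrite 2!mxE [X in X + _ + _]mxE eqxx mulr1n addrA (mulrC x).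
      by [].
    by rewrite dot_orth.
  - exact: lt0r_neq0.
  - apply: measurableT_comp => //; apply: measurable_funD => //.
    by apply: measurable_funM => //.
rewrite ge0_integralZl//; last first.
  by rewrite lee_fin invr_ge0 ltW.
  apply: measurableT_comp => //; exact: measurable_row_of_tuple_dot.
rewrite IHn// muleA -EFinM detM invfM; congr (_ * _)%E.
apply: eq_integral => y _.
apply: eq_integral => x _; congr (G _).
by rewrite dot_row_of_tuple_cons.
Qed.

(** Exponential densities have mass 1: the symmetrized one bounds e^{-k|x|} above and the one-sided
    one below, so its integral is finite and positive. *)
Let expN_abs (k x : R) : 0 < k ->
  expR (- (k * `|x|)) <= k^-1 * (exponential_pdf k x + exponential_pdf k (- x)).
Proof.
move=> k0; rewrite ler_pdivlMl//.
have [x0|x0] := leP 0 x.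
  rewrite exponential_pdfE//= ger0_norm// mulNr lerDl.
  by apply: exponential_pdf_ge0; exact: ltW.
rewrite [X in _ + X]exponential_pdfE/=; last by rewrite oppr_ge0 ltW.
rewrite ltr0_norm// mulNr lerDr.
by apply: exponential_pdf_ge0; exact: ltW.
Qed.

Let expN_abs_ge (k x : R) : 0 < k ->
  k^-1 * exponential_pdf k x <= expR (- (k * `|x|)).
Proof.
move=> k0; rewrite ler_pdivrMl//.
have [x0|x0] := leP 0 x; last first.
  by rewrite lt0_exponential_pdf// mulr_ge0 ?expR_ge0 ?ltW.
by rewrite exponential_pdfE//= ger0_norm// mulNr.
Qed.

Lemma measurable_expN_norm (k : R) : measurable_fun [set: RT]
   (fun x : RT => (expR (- (k * `|x|)))%:E).
Proof.
apply/measurable_EFinP; apply: measurableT_comp => //.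
apply: measurableT_comp => //; apply: measurable_funM => //.
Qed.

Lemma integral_expN_norm_fin_pos (k : R) : 0 < k ->
  (0 < \int[mu]_x (expR (- (k * `|x|)))%:E < +oo)%E.
Proof.
move=> k0; have k0' := ltW k0.
have mp : measurable_fun [set: RT] (fun x => (exponential_pdf k x)%:E).
  by apply/measurable_EFinP; exact: measurable_exponential_pdf.
have pdf_ge0 x : (0 <= (exponential_pdf k x)%:E)%E.
  by rewrite lee_fin exponential_pdf_ge0.
have mpN : measurable_fun [set: RT] (fun x : RT => (exponential_pdf k (- x))%:E).
  apply: (@measurableT_comp _ _ _ _ _ _ (fun x : RT => (exponential_pdf k x)%:E)) => //.
have intN : (\int[mu]_x (exponential_pdf k (- x))%:E = 1)%E.
  rewrite -[RHS](integral_exponential_pdf k0).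
  have := @ge0_integral_affine (-1) 0 (fun x => (exponential_pdf k x)%:E).
  under eq_integral do rewrite mulN1r addr0.
  by move=> ->//; rewrite ?oppr_eq0 ?oner_eq0// normrN normr1 invr1 mul1e.
apply/andP; split.
  apply: (@lt_le_trans _ _ (\int[mu]_x (k^-1%:E * (exponential_pdf k x)%:E))%E).
    rewrite ge0_integralZl//; last by rewrite lee_fin invr_ge0.
    by rewrite integral_exponential_pdf// mule1 lte_fin invr_gt0.
  apply: ge0_le_integral => //.
  - by move=> x _; rewrite -EFinM lee_fin mulr_ge0 ?invr_ge0 ?exponential_pdf_ge0.
  - exact: measurable_funeM.
  - exact: measurable_expN_norm.
  - by move=> x _; rewrite -EFinM lee_fin expN_abs_ge.
apply: (@le_lt_trans _ _ (\int[mu]_x (k^-1%:E *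
    ((exponential_pdf k x)%:E + (exponential_pdf k (- x))%:E)))%E).
  apply: ge0_le_integral => //.
  - exact: measurable_expN_norm.
  - by apply: measurable_funeM; exact: emeasurable_funD.
  - by move=> x _; rewrite -EFinD -EFinM lee_fin expN_abs.
rewrite ge0_integralZl//; last 3 first.
- exact: emeasurable_funD.
- by move=> x _; exact: adde_ge0.
- by rewrite lee_fin invr_ge0.
by rewrite ge0_integralD// integral_exponential_pdf// intN -EFinD -EFinM ltry.
Qed.

Lemma measurable_expN_enorm n (k : R) : measurable_fun setT
  (fun x : n.-tuple RT => (expR (- (k * enorm (row_of_tuple x))))%:E).
Proof.
have := measurable_row_of_tuple_dot (1%:M : 'M[R]_n) 0.
under eq_fun do rewrite mulmx1 addr0.
move=> mdot; apply/measurable_EFinP; apply: measurableT_comp => //.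
apply: measurableT_comp => //; apply: measurable_funM => //.
have ms : measurable_fun [set: RT] (fun x : RT => Num.sqrt x : RT).
  exact: (continuous_measurable_fun (@sqrt_continuous R)).
rewrite /enorm. 
exact: (measurableT_comp ms mdot).
Qed.

(** From (|x| + |y|) / 2 <= |(x, y)| <= |x| + |y|, the integral lies between products of
    lower-dimensional ones, with rate k below and k / 2 above. *)
Lemma integral_expN_enorm_fin_pos n (k : R) : 0 < k ->
  (0 < \int[lebesgue_tuple n]_x (expR (- (k * enorm (row_of_tuple x))))%:E < +oo)%E.
Proof.
elim: n k => [|n IHn] k k0.
  rewrite integral_dirac//; last exact: measurable_expN_enorm.
  by rewrite diracE mem_set// mul1e lte_fin expR_gt0 ltry.
have cons_le (x : RT) (y : n.-tuple RT) :
    enorm (row_of_tuple [tuple of x :: y]) <= `|x| + enorm (row_of_tuple y).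
  rewrite -ler_sqr ?nnegrE ?addr_ge0 ?enorm_ge0// sqrrD !sqr_enorm.
  rewrite real_normK ?num_real// dot_row_of_tuple_cons -expr2 lerD2r lerDl.
  by rewrite mulrn_wge0// mulr_ge0// enorm_ge0.
have cons_ge (x : RT) (y : n.-tuple RT) :
    (`|x| + enorm (row_of_tuple y)) / 2 <= enorm (row_of_tuple [tuple of x :: y]).
  set v := row_of_tuple [tuple of x :: y].
  have ler a : 0 <= a -> a ^+ 2 <= dot v v -> a <= enorm v.
    by move=> a0 h; rewrite -ler_sqr ?nnegrE ?enorm_ge0// sqr_enorm.
  have h1 : `|x| <= enorm v.
    apply: ler => //; rewrite real_normK ?num_real// dot_row_of_tuple_cons -expr2.
    by rewrite lerDl dot_ge0.
  have h2 : enorm (row_of_tuple y) <= enorm v.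
    apply: ler; rewrite ?enorm_ge0// sqr_enorm dot_row_of_tuple_cons -expr2.
    by rewrite lerDr sqr_ge0.
  by rewrite ler_pdivrMr//; lra.
rewrite ge0_integral_tupleS; last 2 first.
- exact: measurable_expN_enorm.
- by move=> x; rewrite lee_fin expR_ge0.
have mcons : measurable_fun setT (@cons_pair R n) by exact: measurable_cons.
have mK : measurable_fun setT (fun y : n.-tuple RT =>
    \int[mu]_x (expR (- (k * enorm (row_of_tuple [tuple of x :: y]))))%:E)%E.
  apply: (measurable_fun_fubini_tonelli_G (fun p : RT * n.-tuple RT =>
    (expR (- (k * enorm (row_of_tuple (cons_pair p)))))%:E)) => [|p].
    exact: (measurableT_comp (@measurable_expN_enorm n.+1 k) mcons).
  by rewrite lee_fin expR_ge0.
have mk1 h (y : n.-tuple RT) : measurable_fun setT (fun x : RT =>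
    ((expR (- (h * `|x|)))%:E * (expR (- (h * enorm (row_of_tuple y))))%:E)%E).
  by apply: emeasurable_funM => //; exact: measurable_expN_norm.
have mk2 (y : n.-tuple RT) : measurable_fun setT (fun x : RT =>
    (expR (- (k * enorm (row_of_tuple [tuple of x :: y]))))%:E).
  have mc : measurable_fun [set: RT] (fun x : RT => [tuple of x :: y]).
    exact: measurable_cons.
  exact: (measurableT_comp (@measurable_expN_enorm n.+1 k) mc).
have prodE h : (\int[lebesgue_tuple n]_y \int[mu]_x
    ((expR (- (h * `|x|)))%:E * (expR (- (h * enorm (row_of_tuple y))))%:E) =
  \int[mu]_x (expR (- (h * `|x|)))%:E *
  \int[lebesgue_tuple n]_x (expR (- (h * enorm (row_of_tuple x))))%:E)%E.
  rewrite -ge0_integralZl; last 4 first.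
  - exact: measurableT.
  - exact: measurable_expN_enorm.
  - by move=> x _; rewrite lee_fin expR_ge0.
  - by apply: integral_ge0 => x _; rewrite lee_fin expR_ge0.
  apply: eq_integral => y _.
  rewrite ge0_integralZr//; first exact: measurable_expN_norm.
have c1 h : (0 <= \int[mu]_x (expR (- (h * `|x|)))%:E)%E.
  by apply: integral_ge0 => x _; rewrite lee_fin expR_ge0.
have mprod h : measurable_fun setT (fun y : n.-tuple RT => \int[mu]_x
    ((expR (- (h * `|x|)))%:E * (expR (- (h * enorm (row_of_tuple y))))%:E))%E.
  apply: (measurable_fun_fubini_tonelli_G (fun p : RT * n.-tuple RT =>
    ((expR (- (h * `|p.1|)))%:E * (expR (- (h * enorm (row_of_tuple p.2))))%:E)%E)) => [|p].
    apply: emeasurable_funM.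
      exact: (measurableT_comp (measurable_expN_norm h) measurable_fst).
    exact: (measurableT_comp (@measurable_expN_enorm n h) measurable_snd).
  by rewrite -EFinM lee_fin mulr_ge0 ?expR_ge0.
apply/andP; split.
  have /andP[c1_gt0 _] := integral_expN_norm_fin_pos k0.
  have /andP[In_gt0 _] := IHn _ k0.
  apply: (lt_le_trans (mule_gt0 c1_gt0 In_gt0)).
  rewrite -prodE; apply: ge0_le_integral => // [y _|y _].
    by apply: integral_ge0 => x _; rewrite -EFinM lee_fin mulr_ge0 ?expR_ge0.
  apply: ge0_le_integral => // x _.
  rewrite -EFinM lee_fin -expRD ler_expR -opprD -mulrDr lerN2.
  by rewrite ler_pM2l.
have k2 : 0 < k / 2 by rewrite divr_gt0.
have /andP[_ c1_fin] := integral_expN_norm_fin_pos k2.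
have /andP[_ In_fin] := IHn _ k2.
have c1f : (\int[mu]_x (expR (- (k / 2 * `|x|)))%:E \is a fin_num)%E.
  by rewrite ge0_fin_numE.
apply: le_lt_trans (lte_mul_pinfty (c1 _) c1f In_fin).
rewrite -prodE; apply: ge0_le_integral => // [y _|y _].
  by apply: integral_ge0 => x _; rewrite lee_fin expR_ge0.
apply: ge0_le_integral => // x _.
rewrite -EFinM lee_fin -expRD ler_expR -opprD -mulrDr lerN2.
by rewrite -mulrA ler_pM2l// mulrC.
Qed.

(** Here c is the integral of e^{-|x|}; being finite and positive, it cancels when two candidates
    are compared. *)
Lemma integral_lowner_fun n : exists2 c : R, 0 < c &
  forall (A : affine_map R n) (t : R), affine_invertible A ->
    integral_rV (fun x => (lowner_fun A t x)%:E) =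
    (c * (expR t / `|affine_det A|))%:E.
Proof.
have /andP[c_gt0 c_fin] := @integral_expN_enorm_fin_pos n 1 ltr01.
move: c_gt0 c_fin; set c := (\int[_]_x _)%E => c_gt0 c_fin.
have c_num : c \is a fin_num by rewrite ge0_fin_numE// ltW.
exists (fine c); first by rewrite -lte_fin fineK.
move=> A t uA.
have ms : measurable_fun [set: RT] (fun x : RT => Num.sqrt x : RT).
  exact: (continuous_measurable_fun (@sqrt_continuous R)).
have mG : measurable_fun [set: RT] (fun r : RT => (expR (- (1 * Num.sqrt r)))%:E).
  apply/measurable_EFinP; apply: measurableT_comp => //.
  apply: measurableT_comp => //; apply: measurable_funM => //.
have G0 (r : RT) : (0 <= (expR (- (1 * Num.sqrt r)))%:E)%E.
  by rewrite lee_fin expR_ge0.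
have E := ge0_integral_radial_affine A.2 uA mG G0.
transitivity ((expR t)%:E * \int[lebesgue_tuple n]_x
    (expR (- (1 * enorm (row_of_tuple x *m A.1 + A.2)%R)))%:E)%E.
  rewrite -ge0_integralZl//.
  - apply: eq_integral => x _; rewrite -EFinM /lowner_fun /affine_app.
    by rewrite mul1r addrC expRD.
  - exact: (measurableT_comp mG (measurable_row_of_tuple_dot A.1 A.2)).
rewrite [X in (_ * X)%E]E [X in (_ * (_ * X))%E](_ : _ = c)//.
rewrite -(fineK c_num) -!EFinM; congr (_%:E).
by rewrite mulrA mulrC.
Qed.

End integration.

(** * Means of two ellipsoids *)

Section ellipsoids.
Variable R : realType.

(** The triangle inequality in the plane for the vectors (u, b) and (v, c). *)
Let ler_mean (u v b c X Y Z : R) : 0 <= X -> 0 <= Y -> 0 <= Z ->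
  X ^+ 2 = u ^+ 2 + b ^+ 2 -> Y ^+ 2 = v ^+ 2 + c ^+ 2 ->
  Z ^+ 2 <= ((u + v) / 2) ^+ 2 + ((b + c) / 2) ^+ 2 -> Z <= (X + Y) / 2.
Proof.
move=> X0 Y0 Z0 XE YE ZE.
have XY : u * v + b * c <= X * Y.
  apply: le_trans (ler_norm _) _.
  rewrite -ler_sqr ?nnegrE ?mulr_ge0// real_normK ?num_real// exprMn XE YE.
  rewrite -subr_ge0 (_ : _ - _ = (u * c - v * b) ^+ 2) ?sqr_ge0//; ring.
rewrite -ler_sqr ?nnegrE ?divr_ge0 ?addr_ge0//.
apply: le_trans ZE _.
have -> : ((X + Y) / 2) ^+ 2 = (X ^+ 2 + Y ^+ 2) / 4 + X * Y / 2 by field.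
rewrite XE YE.
have -> : ((u + v) / 2) ^+ 2 + ((b + c) / 2) ^+ 2 =
  (u ^+ 2 + b ^+ 2 + (v ^+ 2 + c ^+ 2)) / 4 + (u * v + b * c) / 2 by field.
by rewrite lerD2l ler_pM2r.
Qed.

Lemma dot_mul_lblock n (a : R) (w : 'cV[R]_n) (M : 'M[R]_n)
    (x : 'rV[R]_(1 + n)) :
  dot (x *m block_mx a%:M 0 w M) (x *m block_mx a%:M 0 w M) =
  (a * lsubmx x 0 0 + (rsubmx x *m w) 0 0) ^+ 2 +
  dot (rsubmx x *m M) (rsubmx x *m M).
Proof.
rewrite -{1 2}[x]hsubmxK mul_row_block mulmx0 add0r dot_row_mx dot_rV1 -expr2.
by rewrite mul_mx_scalar mxE [(a *: lsubmx x) 0 0]mxE.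
Qed.

Lemma dot_split n (x : 'rV[R]_(1 + n)) :
  dot x x = lsubmx x 0 0 ^+ 2 + dot (rsubmx x) (rsubmx x).
Proof. by rewrite -{1 2}[x]hsubmxK dot_row_mx dot_rV1 expr2. Qed.

(* If M is triangular with diagonal 1, the mean of the two norms need not     *)
(* give a strict gain, but the quadratic mean of the third case does; that    *)
(* mean is usable because |det M| = 1 makes the two heights t equal.          *)
Lemma mean_ellipsoid n (M : 'M[R]_n) : M \in unitmx ->
  (exists2 C : 'M[R]_n,
    forall x, enorm (x *m C) <= (enorm x + enorm (x *m M)) / 2 &
    `|\det M| <= \det C ^+ 2) /\
  [\/ M *m M^T = 1%:M,
      exists2 C : 'M[R]_n,
        forall x, enorm (x *m C) <= (enorm x + enorm (x *m M)) / 2 &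
        `|\det M| < \det C ^+ 2 |
      `|\det M| = 1 /\ exists2 C : 'M[R]_n,
        forall x, dot (x *m C) (x *m C) <= (dot x x + dot (x *m M) (x *m M)) / 2 &
        1 < `|\det C| ].
Proof.
elim: n => [|n IHn] in M *.
  move=> _; split; last by apply: Or31; rewrite [LHS]flatmx0 [RHS]flatmx0.
  exists 1%:M => [x|]; last by rewrite !det_mx00 normr1 expr1n.
  by rewrite !thinmx0 enorm0 addr0 mul0r.
move=> uM.
have [H [a [w [M' [HH a_gt0 uM' MHE detM]]]]] := @householder_block R n M uM.
have [[C' C'le C'det] IH] := IHn _ uM'.
have detM'_gt0 : 0 < `|\det M'| by rewrite normr_gt0 -unitfE -unitmxE.
have dotM (x : 'rV_(1 + n)) : dot (x *m M) (x *m M) =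
    (a * lsubmx x 0 0 + (rsubmx x *m w) 0 0) ^+ 2 +
    dot (rsubmx x *m M') (rsubmx x *m M').
  by rewrite -(dot_orth _ _ HH) -!mulmxA MHE dot_mul_lblock.
(* The blocks average those of the identity and of M in triangular form, D standing for a mean of 1
   and M' supplied by induction. *)
have meanC (D : 'M[R]_n) :
    (forall x, enorm (x *m D) <= (enorm x + enorm (x *m M')) / 2) ->
    forall x : 'rV_(1 + n),
    enorm (x *m block_mx ((1 + a) / 2)%:M 0 (2^-1 *: w) D) <=
      (enorm x + enorm (x *m M)) / 2.
  move=> Dle x.
  apply: (@ler_mean (lsubmx x 0 0) (a * lsubmx x 0 0 + (rsubmx x *m w) 0 0)
    (enorm (rsubmx x)) (enorm (rsubmx x *m M'))); rewrite ?enorm_ge0// !sqr_enorm.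
  - exact: dot_split.
  - exact: dotM.
  - rewrite dot_mul_lblock -scalemxAr [X in (_ + X) ^+ 2]mxE; apply: lerD.
      by rewrite le_eqVlt; apply/orP; left; apply/eqP; field.
    by rewrite -sqr_enorm ler_sqr ?nnegrE ?divr_ge0 ?addr_ge0 ?enorm_ge0.
have detC (c : R) (v : 'cV[R]_n) (D : 'M[R]_n) :
    \det (block_mx c%:M 0 v D : 'M[R]_(1 + n)) = c * \det D.
  by rewrite det_lblock det_mx11 mxE eqxx mulr1n.
have amean : a <= ((1 + a) / 2) ^+ 2.
  by rewrite -subr_ge0 (_ : _ - _ = ((1 - a) / 2) ^+ 2) ?sqr_ge0//; field.
split.
  pose C : 'M[R]_(1 + n) := block_mx ((1 + a) / 2)%:M 0 (2^-1 *: w) C'.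
  exists C; first exact: meanC.
  by rewrite detC exprMn detM ler_pM// ltW.
(* For a != 1 the inequality between arithmetic and geometric means of 1 and a is strict, which is a
   gain whatever M' is. *)
have [a1|a1] := eqVneq a 1; last first.
  apply: Or32.
  pose C : 'M[R]_(1 + n) := block_mx ((1 + a) / 2)%:M 0 (2^-1 *: w) C'.
  exists C; first exact: meanC.
  rewrite detC exprMn detM; apply: (@lt_le_trans _ _ (((1 + a) / 2) ^+ 2 * `|\det M'|)).
    rewrite ltr_pM2r// -subr_gt0 (_ : _ - _ = ((1 - a) / 2) ^+ 2); last by field.
    by rewrite exprn_even_gt0//= mulf_neq0 ?invr_neq0// subr_eq0 eq_sym.
  by rewrite ler_pM2l// (lt_le_trans a_gt0).
case: IH => [M'M'|[D Dle Ddet]|[detM'1 [D Dle Ddet]]].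
- have detM1 : `|\det M| = 1 by rewrite detM a1 mul1r norm_det_orth.
  have [w0|w0] := eqVneq w 0.
    apply: Or31.
    have -> : M *m M^T = (M *m H) *m (M *m H)^T.
      by rewrite trmx_mul mulmxA -(mulmxA M) HH mulmx1.
    have : (block_mx 1%:M 0 0 M' : 'M[R]_(1 + n)) *m (block_mx 1%:M 0 0 M')^T =
        1%:M.
      rewrite tr_block_mx !trmx0 trmx1 mulmx_block.
      by rewrite !(mulmx0, mul0mx, addr0, add0r, mulmx1) M'M' -scalar_mx_block.
    by rewrite MHE a1 w0.
  apply: Or33; split => //; pose u := w^T.
  have uu : 0 < dot u u by rewrite lt0r dot_eq0 dot_ge0 trmx_eq0 w0.
  (* Chosen so that 2 k + k^2 |u|^2 <= 1 / 4. *)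
  pose k := (12 + dot u u)^-1.
  have k_gt0 : 0 < k by rewrite invr_gt0 addr_gt0.
  pose C : 'M[R]_(1 + n) :=
    block_mx 1%:M 0 (2^-1 *: w) (1%:M + k *: (u^T *m u)).
  exists C; last first.
    rewrite detC mul1r scalemxAr det_rank1 dotZl gtr0_norm ?ltrDl ?addr_gt0//;
    by rewrite mulr_gt0.
  suff h (x : 'rV[R]_(1 + n)) :
    dot (x *m C) (x *m C) <= (dot x x + dot (x *m M) (x *m M)) / 2 by [].
  rewrite dot_mul_lblock dot_split dotM a1 !mul1r.
  have M'dot y : dot (y *m M') (y *m M') = dot y y by rewrite dot_orth.
  rewrite M'dot -scalemxAr [((2^-1 *: _) : 'M[R]_1) 0 0]mxE.
  have -> : (rsubmx x *m w) 0 0 = dot (rsubmx x) u by rewrite /dot trmxK.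
  rewrite mulmxDr mulmx1 -scalemxAr mul_tr_rV scalerA.
  rewrite !(dotDl, dotDr, dotZl, dotZr) (dotC u).
  (* The first coordinate leaves a slack: (p^2 + (p + q)^2) / 2 - (p + q / 2)^2 = q^2 / 4. It pays
     for the stretch along u, which costs (2 k + k^2 |u|^2) q^2. *)
  set q := dot (rsubmx x) u; set p := lsubmx x 0 0; set r := dot (rsubmx x) _.
  have kk : k * k * dot u u <= k.
    rewrite -mulrA ler_piMr ?(ltW k_gt0)// mulrC ler_pdivrMr ?addr_gt0// mul1r.
    by rewrite lerDr.
  have k12 : k <= 12^-1 by rewrite lef_pV2 ?posrE ?addr_gt0// lerDl ltW.
  have : k * k * dot u u * q ^+ 2 <= k * q ^+ 2 by rewrite ler_wpM2r ?sqr_ge0.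
  have : k * q ^+ 2 <= 12^-1 * q ^+ 2 by rewrite ler_wpM2r ?sqr_ge0.
  lra.
- apply: Or32.
  pose C : 'M[R]_(1 + n) := block_mx ((1 + a) / 2)%:M 0 (2^-1 *: w) D.
  exists C; first exact: meanC.
  by rewrite detC exprMn detM a1 mul1r (_ : (1 + 1) / 2 = 1) ?expr1n ?mul1r//; field.
- apply: Or33; split; first by rewrite detM a1 mul1r.
  pose C : 'M[R]_(1 + n) := block_mx 1%:M 0 (2^-1 *: w) D.
  exists C; last by rewrite detC mul1r.
  suff h (x : 'rV[R]_(1 + n)) :
    dot (x *m C) (x *m C) <= (dot x x + dot (x *m M) (x *m M)) / 2 by [].
  rewrite dot_mul_lblock dot_split dotM a1 !mul1r.
  rewrite -scalemxAr [((2^-1 *: _) : 'M[R]_1) 0 0]mxE.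
  set q := (rsubmx x *m w) 0 0; set p := lsubmx x 0 0.
  have := Dle (rsubmx x); have := sqr_ge0 q; lra.
Qed.

End ellipsoids.

(** * Loewner and John optimizers *)

Section duality.
Variables (R : realType) (n : nat) (f : 'rV[R]_n -> R).
Hypotheses (f_ge0 : forall x, 0 <= f x) (f_even : forall x, f (- x) = f x).
Hypothesis f_pos : exists x, 0 < f x.

Lemma lowner_feasibleE (A : affine_map R n) (t : R) :
  lowner_feasible f A t <->
  affine_invertible A /\ forall x, f x <= lowner_fun A t x.
Proof.
suff E x : ((enorm (affine_app A x) - t)%:E <= potential f x)%E =
    (f x <= lowner_fun A t x).
  by split=> -[uA h]; split=> // x; have := h x; rewrite E.
rewrite /potential /lowner_fun; have := f_ge0 x.
rewrite le_eqVlt => /orP[/eqP <-|fx_gt0].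
  by rewrite le0_lneNy// leey expR_ge0.
rewrite lne_EFin// -EFinN lee_fin -[in RHS](lnK fx_gt0) ler_expR.
by rewrite lerNr opprB addrC.
Qed.

Lemma lowner_minimizerE (A : affine_map R n) (t : R) :
  lowner_minimizer f A t <->
  lowner_feasible f A t /\ forall A' t', lowner_feasible f A' t' ->
    expR t / `|affine_det A| <= expR t' / `|affine_det A'|.
Proof.
have [c c_gt0 cE] := integral_lowner_fun R n.
split=> -[fA h]; split=> // A' t' fA'; have := h _ _ fA';
  by rewrite !cE ?lee_fin ?ler_pM2l//; [exact: fA'.1|exact: fA.1].
Qed.

Lemma polar_ge0 y : 0 <= polar f y.
Proof.
apply: lb_le_inf.
  by have [x fx] := f_pos; exists (expR (- dot x y) / f x), x.
by move=> _ [x _ <-]; rewrite divr_ge0 ?expR_ge0.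
Qed.

(** An infimum is at least s iff all members are. Points with f x = 0 satisfy the inequality
    trivially, and [f_pos] keeps the infimum off the empty set. *)
Lemma le_polar s y : 0 < s ->
  s <= polar f y <-> forall x, s * f x <= expR (- dot x y).
Proof.
move=> s_gt0; split=> [sf x|h].
  have := f_ge0 x; rewrite le_eqVlt => /orP[/eqP <-|fx_gt0].
    by rewrite mulr0 expR_ge0.
  rewrite -ler_pdivlMr//; apply: le_trans sf _; apply: ge_inf; last by exists x.
  by exists 0 => _ [z _ <-]; rewrite divr_ge0 ?expR_ge0.
apply: lb_le_inf.
  by have [x fx] := f_pos; exists (expR (- dot x y) / f x), x.
by move=> _ [x /= fx <-]; rewrite ler_pdivlMr.
Qed.

(** The largest value of <x, .> on the ellipsoid, up to replacing x by -x, is governed by |x A^T|;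
    the bound by the sup norm follows from the value of the polar at the centre. *)
Lemma john_feasible_polarE s (A : affine_map R n) :
  john_feasible (polar f) s A <->
  [/\ 0 < s, affine_invertible A &
      forall x, s * f x <= expR (- (enorm (x *m A.1^T) + dot x A.2))].
Proof.
split=> [[s_gt0 _ uA h]|[s_gt0 uA h]].
  split=> // x; set u := x *m A.1^T.
  (* The point of the ball where <u, .> is maximal; if u = 0 the inverse is 0 and z = 0 still
     works. *)
  pose z := (enorm u)^-1 *: u.
  have zB : eball z.
    rewrite /eball /= enormZ ger0_norm ?invr_ge0 ?enorm_ge0//.
    have [->|u0] := eqVneq (enorm u) 0; first by rewrite mulr0.
    by rewrite mulVf.
  have := h (affine_app A z); rewrite /john_fun indicE mem_set; last by exists z.
  rewrite mulr1 => /(le_polar _ s_gt0)/(_ x) /le_trans; apply.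
  rewrite ler_expR lerN2 /affine_app dotDr lerD2r.
  rewrite (dotC x) dot_mulmx dotZl -/u -sqr_enorm.
  have [->|u0] := eqVneq (enorm u) 0; first by rewrite expr0n mulr0.
  by rewrite expr2 mulKf.
have sP z : eball z -> s <= polar f (affine_app A z).
  move=> zB; apply/le_polar => // x; apply: le_trans (h x) _.
  rewrite ler_expR lerN2 /affine_app dotDr lerD2r (dotC x) dot_mulmx.
  apply: le_trans (ler_norm _) _; apply: le_trans (dot_enorm _ _) _.
  by rewrite ler_piMl ?enorm_ge0.
split=> //.
  have B0 : eball (0 : 'rV[R]_n) by rewrite /eball /= enorm0.
  apply: (@le_trans _ _ (`|polar f (affine_app A 0)|%:E)).
    by rewrite lee_fin; apply: le_trans (sP _ B0) (ler_norm _).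
  by apply: ereal_sup_ubound; exists (affine_app A 0).
move=> y; rewrite /john_fun indicE.
case: (boolP (y \in _)) => [|_]; last by rewrite mulr0 polar_ge0.
by rewrite inE => -[z zB <-]; rewrite mulr1 sP.
Qed.

Lemma john_feasible_even s (A : affine_map R n) x :
  john_feasible (polar f) s A ->
  s * f x <= expR (- (enorm (x *m A.1^T) + `|dot x A.2|)).
Proof.
move=> /john_feasible_polarE[_ _ h]; case: (ger0P (dot x A.2)) => _; first exact: h.
by have := h (- x); rewrite f_even mulNmx enormN dotNl.
Qed.

Lemma lowner_john_feasible (A : 'M[R]_n) t :
  lowner_feasible f (A, 0) t <-> john_feasible (polar f) (expR (- t)) (A^T, 0).
Proof.
rewrite lowner_feasibleE john_feasible_polarE /affine_invertible /= unitmx_tr.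
split=> [[uA h]|[_ uA h]]; split; rewrite ?expR_gt0// => x.
- rewrite trmxK dot0r addr0 expRN ler_pdivrMl ?expR_gt0// -expRD addrC.
  by have := h x; rewrite /lowner_fun /affine_app /= addr0.
- have := h x; rewrite trmxK dot0r addr0 expRN ler_pdivrMl ?expR_gt0// -expRD addrC.
  by rewrite /lowner_fun /affine_app /= addr0.
Qed.

(* One of |x A + b|, |- x A + b| is at least (|x A|^2 + |b|^2)^(1/2), hence at *)
(* least l |x A| + m |b| by Cauchy-Schwarz.                                   *)
Lemma lowner_feasible_center (A : affine_map R n) t (l m : R) :
  lowner_feasible f A t -> 0 < l -> 0 <= m -> l ^+ 2 + m ^+ 2 = 1 ->
  lowner_feasible f (l *: A.1, 0) (t - m * enorm A.2).
Proof.
move=> /lowner_feasibleE[uA h] l_gt0 m_ge0 lm; apply/lowner_feasibleE; split.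
  by rewrite /affine_invertible /= unitmxZ// unitfE lt0r_neq0.
move=> x; rewrite /lowner_fun /affine_app /= addr0 -scalemxAr.
have key u : 0 <= dot u A.2 -> enorm (l *: u) + m * enorm A.2 <= enorm (u + A.2).
  move=> ub; rewrite enormZ gtr0_norm//.
  rewrite -ler_sqr ?nnegrE ?addr_ge0 ?mulr_ge0 ?enorm_ge0 ?(ltW l_gt0)//.
  apply: (@le_trans _ _ (enorm u ^+ 2 + enorm A.2 ^+ 2)).
    rewrite -[leRHS]mul1r -lm -subr_ge0.
    rewrite (_ : _ - _ = (l * enorm A.2 - m * enorm u) ^+ 2) ?sqr_ge0//; ring.
  by rewrite !sqr_enorm !(dotDl, dotDr) (dotC A.2); lra.
have [d0|d0] := leP 0 (dot (x *m A.1) A.2).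
  apply: le_trans (h x) _; rewrite /lowner_fun /affine_app ler_expR.
  by have := key _ d0; lra.
rewrite -f_even; apply: le_trans (h (- x)) _.
rewrite /lowner_fun /affine_app ler_expR.
have := key (- (x *m A.1)); rewrite dotNl oppr_ge0 => /(_ (ltW d0)).
by rewrite scalerN enormN mulNmx; lra.
Qed.

(** Recentring lowers t by m |b|, of first order in m, and costs a factor l^n in the determinant, of
    second order in m. *)
Lemma lowner_minimizer_center (A : affine_map R n) t :
  lowner_minimizer f A t -> A.2 = 0.
Proof.
move=> /lowner_minimizerE[fA minA]; apply/eqP; apply: contraT => b0.
set b := enorm A.2; have b_gt0 : 0 < b by rewrite enorm_gt0.
(* With m < 1 this gives n m (1 + m b) <= n m (1 + b) = b n / (n + 1) < b, contradicting the bound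
   [le2] below. *)
pose m := b / (n.+1%:R * (1 + b)).
have m_gt0 : 0 < m by rewrite divr_gt0// mulr_gt0// addr_gt0.
have m_lt1 : m < 1.
  rewrite ltr_pdivrMr ?mulr_gt0 ?addr_gt0// mul1r.
  apply: (@lt_le_trans _ _ (1 + b)); first by rewrite ltrDr.
  by rewrite ler_peMl ?addr_ge0 ?(ltW b_gt0)// ler1n.
have m2_lt1 : m ^+ 2 < 1 by rewrite expr_lt1// ltW.
pose l := Num.sqrt (1 - m ^+ 2).
have l_gt0 : 0 < l by rewrite sqrtr_gt0 subr_gt0.
have l2 : l ^+ 2 = 1 - m ^+ 2 by rewrite sqr_sqrtr// subr_ge0 ltW.
have lm : l ^+ 2 + m ^+ 2 = 1 by rewrite l2 subrK.
(* For l = (1 - m^2)^(1/2), minimality gives l^n <= e^{- m b}, whereas        *)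
(* l^n >= 1 - n m^2.                                                          *)
have := minA _ _ (lowner_feasible_center fA l_gt0 (ltW m_gt0) lm).
have d_gt0 : 0 < `|affine_det A| by rewrite normr_gt0 -unitfE -unitmxE; exact: fA.1.
rewrite /affine_det /= detZ normrM (gtr0_norm (exprn_gt0 _ l_gt0)) -/b.
rewrite ler_pdivrMr// invfM mulrA divfK ?lt0r_neq0//.
rewrite ler_pdivlMr ?exprn_gt0// expRD ler_pM2l ?expR_gt0// => lnle.
have bern k : 1 - k%:R * m ^+ 2 <= l ^+ k.
  elim: k => [|k IHk]; first by rewrite mul0r subr0.
  have l_le1 : l <= 1 by rewrite -sqrtr1 ler_sqrt// lerBlDr lerDl sqr_ge0.
  have l_ge : 1 - m ^+ 2 <= l by rewrite -l2 expr2 ler_piMl// ltW.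
  have lk_le1 : l ^+ k <= 1 by rewrite exprn_ile1// ltW.
  have : 0 <= (1 - l) * (1 - l ^+ k) by rewrite mulr_ge0 ?subr_ge0.
  rewrite [l ^+ k.+1]exprS -natr1; move: IHk l_ge; move: (l ^+ k) (m ^+ 2) => L q.
  nra.
have := le_trans (bern n) lnle; rewrite expRN => le1.
have mb_gt0 : 0 < 1 + m * b by rewrite addr_gt0// mulr_gt0.
have : 1 - n%:R * m ^+ 2 <= (1 + m * b)^-1.
  by apply: le_trans le1 _; rewrite lef_pV2 ?posrE ?expR_gt0// expR_ge1Dx.
rewrite -[_^-1]mul1r ler_pdivlMr// => le2.
have {}le2 : m * b <= m * (n%:R * m * (1 + m * b)) by lra.
move: le2; rewrite ler_pM2l// leNgt => /negP; case.
apply: (@le_lt_trans _ _ (n%:R * m * (1 + b))).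
  apply: ler_wpM2l; first by apply: mulr_ge0 => //; exact: ltW.
  by rewrite lerD2l ler_piMl ?ltW.
rewrite (_ : _ * _ * _ = b * (n%:R / n.+1%:R)).
  by rewrite gtr_pMr// ltr_pdivrMr// mul1r ltr_nat.
rewrite /m; field.
by rewrite -(natrD _ 1 n) pnatr_eq0 lt0r_neq0 ?addr_gt0.
Qed.

(** Evenness puts |<x, b>| in the constraint. With u = x A^T and b = c A, one has |u P| <= |u| +
    |<u, c>| = |u| + |<x, b>|, so the stretched centred ellipsoid is admissible and strictly
    larger. *)
Lemma john_maximizer_center s (A : affine_map R n) :
  john_maximizer (polar f) s A -> A.2 = 0.
Proof.
move=> [fA maxA]; apply/eqP; apply: contraT => b0.
have [s_gt0 uA _] := (john_feasible_polarE s A).1 fA.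
pose c := A.2 *m invmx A.1.
have c0 : c != 0.
  by apply: contra_neq b0 => c0; rewrite -[LHS](mulmxKV uA) -/c c0 mul0mx.
have c_gt0 : 0 < enorm c by rewrite enorm_gt0.
pose c1 := (enorm c)^-1 *: c.
(* P stretches the direction of c by the factor 1 + |c|. *)
pose P := 1%:M + c1^T *m c.
have detP : \det P = 1 + enorm c.
  by rewrite det_rank1 dotZr -sqr_enorm expr2 mulKf ?lt0r_neq0.
have detP_gt1 : 1 < \det P by rewrite detP ltrDl.
have feas : john_feasible (polar f) s (P^T *m A.1, 0).
  apply/john_feasible_polarE; split=> //.
    rewrite /affine_invertible /= unitmx_mul unitmx_tr [A.1 \in _]uA andbT.
    rewrite unitmxE unitfE.
    by rewrite lt0r_neq0// (lt_trans ltr01).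
  move=> x; apply: le_trans (john_feasible_even x fA) _.
  rewrite ler_expR lerN2 /= dot0r addr0 trmx_mul trmxK mulmxA.
  rewrite mulmxDr mulmx1 mul_tr_rV; apply: le_trans (ler_enormD _ _) _.
  rewrite lerD2l enormZ /c1 dotZr normrM normfV (ger0_norm (enorm_ge0 c)).
  rewrite mulrC mulVKf ?lt0r_neq0// dot_mulmx trmxK.
  by rewrite /c mulmxKV.
have d_gt0 : 0 < `|affine_det A| by rewrite normr_gt0 -unitfE -unitmxE.
have := maxA _ _ feas; rewrite ler_pM2l// /affine_det /= det_mulmx det_tr normrM.
rewrite ger_pMl// (gtr0_norm (lt_trans ltr01 detP_gt1)) => /(lt_le_trans detP_gt1).
by rewrite ltxx.
Qed.

Lemma lowner_minimizer_unique (A1 A2 : 'M[R]_n) t1 t2 :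
  lowner_minimizer f (A1, 0) t1 -> lowner_minimizer f (A2, 0) t2 ->
  lowner_fun (A1, 0) t1 = lowner_fun (A2, 0) t2.
Proof.
move=> /lowner_minimizerE[f1 min1] /lowner_minimizerE[f2 min2].
have [u1 h1] := (lowner_feasibleE (A1, 0) t1).1 f1.
have [u2 h2] := (lowner_feasibleE (A2, 0) t2).1 f2.
rewrite /affine_invertible /= in u1 u2.
have d1 : 0 < `|\det A1| by rewrite normr_gt0 -unitfE -unitmxE.
have d2 : 0 < `|\det A2| by rewrite normr_gt0 -unitfE -unitmxE.
have vE : expR t1 / `|\det A1| = expR t2 / `|\det A2|.
  by apply/eqP; rewrite eq_le (min1 _ _ f2) (min2 _ _ f1).
pose M := invmx A2 *m A1.
have A2M : A2 *m M = A1 by rewrite /M mulKVmx.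
have uM : M \in unitmx by rewrite unitmx_mul unitmx_inv u2.
have detM : `|\det M| = expR (t1 - t2).
  have : `|\det A1| = `|\det A2| * `|\det M| by rewrite -normrM -det_mulmx A2M.
  move: vE => /eqP; rewrite eqr_div ?lt0r_neq0// => /eqP vE d12.
  apply: (mulfI (lt0r_neq0 d2)); rewrite -d12 expRD expRN mulrA.
  by rewrite (mulrC `|\det A2|) vE mulrAC divff ?mul1r// lt0r_neq0// expR_gt0.
have h x : f x <= expR (- enorm (x *m A1) + t1) /\
    f x <= expR (- enorm (x *m A2) + t2).
  by have := h1 x; have := h2 x; rewrite /lowner_fun /affine_app /= !addr0.
(* Such a C would give a candidate strictly better than (A2, t2). *)
have contr (C : 'M[R]_n) t : expR (t - t2) < `|\det C| ->
    (forall x, f x <= expR (- enorm (x *m (A2 *m C)) + t)) -> False.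
  move=> Ct hC; have detC_gt0 := lt_trans (expR_gt0 _) Ct.
  have feas : lowner_feasible f (A2 *m C, 0) t.
    apply/lowner_feasibleE; split.
      by rewrite /affine_invertible /= unitmx_mul u2 unitmxE unitfE -normr_gt0.
    by move=> x; rewrite /lowner_fun /affine_app /= addr0.
  have := min2 _ _ feas; rewrite /affine_det /= det_mulmx normrM.
  rewrite ler_pdivrMr// (mulrC `|_|) invfM mulrA divfK ?lt0r_neq0//.
  rewrite ler_pdivlMr// mulrC -ler_pdivlMr ?expR_gt0// -expRN -expRD.
  by rewrite leNgt Ct.
case: (mean_ellipsoid uM).2 => [MM|[C Cle Cdet]|[detM1 [C Cle Cdet]]].
- have t12 : t1 = t2.
    by apply/subr0_eq/expR_inj; rewrite expR0 -detM norm_det_orth.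
  apply/funext => x; rewrite /lowner_fun /affine_app /= !addr0 t12.
  by rewrite -A2M mulmxA enorm_orth.
(* f lies below both candidates, hence below their geometric mean, whose exponent averages the norms
   and the heights. *)
- exfalso; apply: (contr C ((t1 + t2) / 2)).
    rewrite -ltr_sqr ?nnegrE ?expR_ge0// real_normK ?num_real//.
    apply: le_lt_trans Cdet; rewrite detM -expRM_natl ler_expR; lra.
  move=> x; have [g1 g2] := h x.
  have : enorm (x *m (A2 *m C)) <= (enorm (x *m A2) + enorm (x *m A1)) / 2.
    by have := Cle (x *m A2); rewrite -!mulmxA A2M.
  set N := enorm _ => NC.
  have [le12|/ltW le21] := leP (- enorm (x *m A1) + t1) (- enorm (x *m A2) + t2).
    by apply: le_trans g1 _; rewrite ler_expR; lra.
  by apply: le_trans g2 _; rewrite ler_expR; lra.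
(* At equal heights f is bounded using the larger of the two norms, which dominates their quadratic
   mean. *)
- have t12 : t1 = t2.
    by apply/subr0_eq/expR_inj; rewrite expR0 -detM.
  exfalso; apply: (contr C t2); first by rewrite subrr expR0.
  move=> x; have [] := h x; rewrite t12 => g1 g2.
  have := Cle (x *m A2); rewrite -!mulmxA A2M -!sqr_enorm.
  set N := enorm _ => NC.
  have [le12|/ltW le21] := leP (enorm (x *m A1)) (enorm (x *m A2)).
    apply: le_trans g2 _; rewrite ler_expR lerD2r lerN2.
    rewrite -ler_sqr ?nnegrE ?enorm_ge0//.
    have : enorm (x *m A1) ^+ 2 <= enorm (x *m A2) ^+ 2.
      by rewrite ler_sqr ?nnegrE ?enorm_ge0.
    by lra.
  apply: le_trans g1 _; rewrite ler_expR lerD2r lerN2.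
  rewrite -ler_sqr ?nnegrE ?enorm_ge0//.
  have : enorm (x *m A2) ^+ 2 <= enorm (x *m A1) ^+ 2.
    by rewrite ler_sqr ?nnegrE ?enorm_ge0.
  by lra.
Qed.

(** Put u = x A and y = z A^T: the exponent |u| - <u, z> - t is least at u = 0 if |z| <= 1, and is
    unbounded below along u = k z otherwise. *)
Lemma polar_lowner_fun (A : 'M[R]_n) t : A \in unitmx ->
  polar (lowner_fun (A, 0) t) = john_fun (expR (- t)) (A^T, 0).
Proof.
move=> uA; apply/funext => y.
have gE x : lowner_fun (A, 0) t x = expR (- enorm (x *m A) + t).
  by rewrite /lowner_fun /affine_app /= addr0.
have uAT : A^T \in unitmx by rewrite unitmx_tr.
pose z := y *m invmx A^T.
have yE : y = z *m A^T by rewrite mulmxKV.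
have dotxy x : dot x y = dot (x *m A) z by rewrite yE dotC dot_mulmx trmxK dotC.
have valE x : expR (- dot x y) / lowner_fun (A, 0) t x =
    expR (enorm (x *m A) - dot (x *m A) z - t).
  by rewrite gE -expRN -expRD dotxy; congr expR; ring.
have lb0 : has_lbound [set expR (- dot x y) / lowner_fun (A, 0) t x |
    x in [set x | 0 < lowner_fun (A, 0) t x]].
  by exists 0 => _ [x _ <-]; rewrite valE expR_ge0.
have pos x : 0 < lowner_fun (A, 0) t x by rewrite expR_gt0.
have mem_y : (y \in affine_app (A^T, 0) @` @eball R n) = (enorm z <= 1).
  apply/idP/idP => [|z1]; rewrite inE.
    move=> [w w1 wy]; rewrite (_ : z = w)//; apply: (can_inj (mulmxK uAT)).
    by rewrite -yE -wy /affine_app /= addr0.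
  by exists z => //; rewrite /affine_app /= addr0.
rewrite /john_fun indicE mem_y; have [z1|z1] := leP (enorm z) 1.
  rewrite mulr1; apply/eqP; rewrite eq_le; apply/andP; split.
    apply: ge_inf => //; exists 0; first exact: pos.
    by rewrite valE mul0mx enorm0 dotC dot0r subrr sub0r.
  apply: lb_le_inf.
    by exists (expR (- dot 0 y) / lowner_fun (A, 0) t 0), 0; [exact: pos|].
  move=> _ [x _ <-]; rewrite valE ler_expR lerDr subr_ge0.
  apply: le_trans (ler_norm _) _; apply: le_trans (dot_enorm _ _) _.
  by rewrite ler_piMr ?enorm_ge0.
rewrite mulr0; apply/eqP; rewrite eq_le; apply/andP; split; last first.
  apply: lb_le_inf.
    by exists (expR (- dot 0 y) / lowner_fun (A, 0) t 0), 0; [exact: pos|].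
  by move=> _ [x _ <-]; rewrite valE expR_ge0.
set s := polar _ _; rewrite leNgt; apply/negP => s_gt0.
pose r := enorm z * (enorm z - 1).
have r_gt0 : 0 < r by rewrite mulr_gt0 ?subr_gt0// (lt_trans ltr01).
(* At u = k z the exponent is - k r - t, and this k brings it below ln s. *)
pose k := (`|t + ln s| + 1) / r.
have k_ge0 : 0 <= k by rewrite divr_ge0 ?(ltW r_gt0).
have : s <= expR (- (k * r) - t).
  rewrite (_ : _ - t = enorm (k *: z *m invmx A *m A)
     - dot (k *: z *m invmx A *m A) z - t); last first.
    by rewrite mulmxKV// enormZ ger0_norm// dotZl -sqr_enorm /r; ring.
  by rewrite -valE; apply: ge_inf => //; exists (k *: z *m invmx A); [exact: pos|].
rewrite -{1}(lnK s_gt0) ler_expR /k divfK ?lt0r_neq0//.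
have := ler_norm (- (t + ln s)); rewrite normrN; lra.
Qed.

Lemma lowner_john_optimal (A : 'M[R]_n) t :
  lowner_minimizer f (A, 0) t <-> john_maximizer (polar f) (expR (- t)) (A^T, 0).
Proof.
have det_gt0 (B : 'M[R]_n) : B \in unitmx -> 0 < `|\det B|.
  by rewrite normr_gt0 -unitfE -unitmxE.
have valV (u : R) (B : 'M[R]_n) : expR u / `|\det B| = (expR (- u) * `|\det B^T|)^-1.
  by rewrite det_tr invfM expRN invrK.
have val_gt0 (u : R) (B : 'M[R]_n) : B \in unitmx -> 0 < expR (- u) * `|\det B^T|.
  by move=> uB; rewrite mulr_gt0 ?expR_gt0// det_tr det_gt0.
rewrite lowner_minimizerE /john_maximizer -lowner_john_feasible.
split=> -[fA opt]; split=> //; have uA : A \in unitmx := fA.1.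
- move=> s' A' fA'; have [s'_gt0 uA' _] := (john_feasible_polarE s' A').1 fA'.
  have fA'T : lowner_feasible f (A'.1^T, 0) (- ln s').
    apply/lowner_john_feasible; rewrite opprK lnK// trmxK.
    apply/john_feasible_polarE; split=> // x; rewrite dot0r addr0.
    apply: le_trans (john_feasible_even x fA') _.
    by rewrite ler_expR lerN2 lerDl.
  have := opt _ _ fA'T; rewrite /affine_det /= !valV opprK lnK// trmxK.
  rewrite lef_pV2 ?posrE ?val_gt0// mulr_gt0// normr_gt0 -unitfE -unitmxE.
  exact: uA'.
- move=> A' t' fA'.
  have fA'0 : lowner_feasible f (A'.1, 0) t'.
    (* The choice l = 1, m = 0 recentres a competitor without changing its objective. *)
    have := @lowner_feasible_center A' t' 1 0 fA' ltr01 (lexx _).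
    by rewrite expr1n expr0n addr0 scale1r mul0r subr0; apply.
  have := opt _ _ ((lowner_john_feasible _ _).1 fA'0); rewrite /affine_det /= !valV.
  by rewrite lef_pV2 ?posrE ?val_gt0//; exact: fA'0.1.
Qed.

Lemma polar_lowner : polar (lowner f) = john (polar f).
Proof.
have uniq A t s B : lowner_minimizer f A t -> john_maximizer (polar f) s B ->
    polar (lowner_fun A t) = john_fun s B.
  case: A B => [A a] [B b] mA mB.
  have /= a0 := lowner_minimizer_center mA; have /= b0 := john_maximizer_center mB.
  have [s_gt0 uB _] := (john_feasible_polarE s _).1 mB.1.
  rewrite {}a0 {}b0 in mA mB *.
  have mBT : lowner_minimizer f (B^T, 0) (- ln s).
    by apply/lowner_john_optimal; rewrite opprK lnK// trmxK.
  rewrite (lowner_minimizer_unique mA mBT) polar_lowner_fun ?unitmx_tr//.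
  by rewrite opprK lnK// trmxK.
rewrite /lowner /john.
case: (xgetP _ [set g | exists A t, lowner_minimizer f A t /\ g = lowner_fun A t]).
  move=> g gE [A [t [mA ->]]].
  case: xgetP => [h hE [s [B [mB ->]]]|noB]; first exact: uniq.
  case: (noB (john_fun (expR (- t)) (A.1^T, 0))).
  exists (expR (- t)), (A.1^T, 0); split=> //; apply/lowner_john_optimal.
  by rewrite -(lowner_minimizer_center mA); case: A mA {gE}.
move=> noA; case: xgetP => [h hE [s [B [mB _]]]|_].
  have [s_gt0 uB _] := (john_feasible_polarE s _).1 mB.1.
  case: (noA (lowner_fun (B.1^T, 0) (- ln s))); exists (B.1^T, 0), (- ln s).
  split=> //; apply/lowner_john_optimal; rewrite opprK lnK// trmxK.
  by rewrite -(john_maximizer_center mB); case: B mB {hE uB}.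
(* Without optimizers both choices default to 0, and the polar of 0 is the infimum of the empty set,
   which is 0. *)
apply/funext => y; rewrite /polar (_ : [set x | 0 < 0] = set0).
  by rewrite image_set0 inf0.
by apply/seteqP; split=> x //=; rewrite ltxx.
Qed.

End duality.

Theorem proposition5 (R : realType) (n : nat)
    (psi : 'rV[R]_n -> \bar R) (f : 'rV[R]_n -> R)
    (psi_convex : econvex psi)
    (f_expN_psi : is_expN f psi)
    (psi_even : forall x : 'rV[R]_n, psi x = psi (- x)%R)
    (f_nondegenerate : nondegenerate_log_concave f)
    (f_integrable : integrable_log_concave f) :
  polar (lowner f) = john (polar f).
Proof.
have fE x : f x = fine (expeR (- psi x)) by rewrite -f_expN_psi.
apply: polar_lowner => [x|x|].
- by rewrite -lee_fin f_expN_psi expeR_ge0.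
- by rewrite !fE -psi_even.
- by have [x /interior_subset fx] := f_nondegenerate; exists x.
Qed.
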